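(* Let $k$ be an algebraically closed field and let $\mathcal{C}$ be a Hom-finite, Krull-Schmidt, $k$-linear triangulated category with shift $\Sigma$ and with a Serre functor $\mathcal{S}$. Let $M$ be an indecomposable object of $\mathcal{C}$ for which there are no irreducible maps $\Sigma^rM\to M$ for any $r\in\mathbb{Z}$, and let $F:\mathcal{C}\to\mathcal{C}$ be a $k$-linear endofunctor. Suppose that $\alpha:\mathrm{Id}_{\mathcal{C}}\to F$ is a natural transformation whose support is contained in $\{\Sigma^rM \mid r\in\mathbb{Z}\}$. Then $F(M)\cong\mathcal{S}(M)$, and for each $r\in\mathbb{Z}$ the map $\alpha_{\Sigma^rM}:\Sigma^rM\to F(\Sigma^rM)$ is almost vanishing. Thus $\alpha$ is one of the natural transformations of the kind constructed by Linckelmann (almost vanishing on the shifts of a single indecomposable object and zero on all other indecomposable objects).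
   Context: The support of a natural transformation $\alpha:F\to G$ of functors on $\mathcal{C}$ is the set of isomorphism classes of indecomposable objects $M$ for which $\alpha_M:F(M)\to G(M)$ is non-zero. A Serre functor on $\mathcal{C}$ is a self-equivalence $\mathcal{S}:\mathcal{C}\to\mathcal{C}$ with bifunctorial isomorphisms $D\mathrm{Hom}_{\mathcal{C}}(X,Y)\cong\mathrm{Hom}_{\mathcal{C}}(Y,\mathcal{S}(X))$ for all $X,Y\in\mathcal{C}$, where $D=\mathrm{Hom}_k(-,k)$. An Auslander-Reiten triangle is a distinguished triangle $X\to Y\xrightarrow{\beta} Z\xrightarrow{\gamma}\Sigma X$ with $X,Z$ indecomposable, $\gamma\neq 0$, and such that every morphism $W\to Z$ that is not a split epimorphism factors through $\beta$. A morphism is almost vanishing if it is the third morphism $\gamma$ of some Auslander-Reiten triangle (so its domain and codomain are indecomposable). Linckelmann's construction: for an indecomposable object $U$ one has a natural transformation $\zeta$ such that $\zeta_V$ is almost vanishing for $V$ a shift $\Sigma^rU$ of $U$, and $\zeta_V=0$ for every indecomposable $V$ not isomorphic to any $\Sigma^rU$ (in the stable module category of a symmetric algebra, $\zeta:\mathrm{Id}\to\Omega$ where $\Omega$ is the Heller operator).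
   Formalization: As stated this fails (e.g. F = 0, α = 0; or F = Id ⊕ Id on D^b(k)); the formal theorem additionally assumes that α is non-zero at Σ^rM and that F(Σ^rM) is indecomposable for every integer r, both of which the conclusion implies. *)

(* Defs.v *)
From HB Require Import structures.
From mathcomp Require Import all_boot all_order all_algebra.
Set Implicit Arguments.
Unset Strict Implicit.
Unset Printing Implicit Defensive.
Import GRing.Theory.
Local Open Scope ring_scope.

(* Hom-finiteness is built in: a [vectType k] is a finite-dimensional
   k-vector space. *)
Record homfin_lincat (k : fieldType) := HomfinLincat {
  obj :> Type;
  mor : obj -> obj -> vectType k;
  idm : forall X, mor X X;
  compm : forall X Y Z, mor Y Z -> mor X Y -> mor X Z;
  comp_linear_l : forall X Y Z (f : mor X Y),
    linear (fun g : mor Y Z => compm g f);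
  comp_linear_r : forall X Y Z (g : mor Y Z),
    linear (fun f : mor X Y => compm g f);
  comp_idl : forall X Y (f : mor X Y), compm (idm Y) f = f;
  comp_idr : forall X Y (f : mor X Y), compm f (idm X) = f;
  comp_assoc : forall X Y Z W (h : mor Z W) (g : mor Y Z) (f : mor X Y),
    compm h (compm g f) = compm (compm h g) f
}.
Arguments mor {k C} X Y : rename.
Arguments idm {k C} X : rename.
Arguments compm {k C X Y Z} g f : rename.

Reserved Notation "g \co f" (at level 40, left associativity).
Notation "g \co f" := (compm g f) : ring_scope.

Section Categories.
Variables (k : fieldType) (C : homfin_lincat k).
Implicit Types X Y Z W : C.

(** * Morphisms and objects *)

(* [linfun] is only meaningful on linear maps; see [precompE], [postcompE]. *)
Definition precomp X Y Z (f : mor X Y) : 'Hom(mor Y Z, mor X Z) :=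
  linfun (fun g => g \co f).

Definition postcomp X Y Z (g : mor Y Z) : 'Hom(mor X Y, mor X Z) :=
  linfun (fun f => g \co f).

Lemma precompE X Y Z (f : mor X Y) (g : mor Y Z) : precomp Z f g = g \co f.
Proof.
pose L := GRing.isLinear.Build k (mor Y Z) (mor X Z) _
  (fun g : mor Y Z => g \co f) (comp_linear_l f).
exact: (lfunE (HB.pack (fun g : mor Y Z => g \co f) L :
  {linear mor Y Z -> mor X Z})).
Qed.

Lemma postcompE X Y Z (g : mor Y Z) (f : mor X Y) : postcomp X g f = g \co f.
Proof.
pose L := GRing.isLinear.Build k (mor X Y) (mor X Z) _
  (fun f : mor X Y => g \co f) (comp_linear_r g).
exact: (lfunE (HB.pack (fun f : mor X Y => g \co f) L :
  {linear mor X Y -> mor X Z})).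
Qed.

Definition is_iso X Y (f : mor X Y) : Prop :=
  exists g : mor Y X, g \co f = idm X /\ f \co g = idm Y.

Definition isomorphic X Y : Prop := exists f : mor X Y, is_iso f.

Definition split_mono X Y (f : mor X Y) : Prop :=
  exists g : mor Y X, g \co f = idm X.

Definition split_epi X Y (f : mor X Y) : Prop :=
  exists g : mor Y X, f \co g = idm Y.

Definition irreducible X Y (f : mor X Y) : Prop :=
  [/\ ~ split_mono f, ~ split_epi f
    & forall W (g : mor X W) (h : mor W Y),
        f = h \co g -> split_mono g \/ split_epi h].

Definition is_zero X : Prop := idm X = 0.

Definition is_biproduct X A B (iA : mor A X) (iB : mor B X)
    (pA : mor X A) (pB : mor X B) : Prop :=
  [/\ pA \co iA = idm A, pB \co iB = idm B, pA \co iB = 0, pB \co iA = 0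
    & iA \co pA + iB \co pB = idm X].

Definition additive_category : Prop :=
  (exists X, is_zero X) /\
  (forall A B, exists X (iA : mor A X) (iB : mor B X)
     (pA : mor X A) (pB : mor X B), is_biproduct iA iB pA pB).

Definition indecomposable X : Prop :=
  ~ is_zero X /\
  forall A B (iA : mor A X) (iB : mor B X) (pA : mor X A) (pB : mor X B),
    is_biproduct iA iB pA pB -> is_zero A \/ is_zero B.

Definition local_end X : Prop :=
  ~ is_zero X /\
  forall f g : mor X X, is_iso (f + g) -> is_iso f \/ is_iso g.

Definition krull_schmidt : Prop :=
  forall X, exists (n : nat) (N : 'I_n -> C)
    (i : forall j, mor (N j) X) (p : forall j, mor X (N j)),
    [/\ forall j, local_end (N j),
        forall j, p j \co i j = idm (N j),
        forall j l, j != l -> p j \co i l = 0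
      & \sum_j (i j \co p j) = idm X].

(** * Functors and natural transformations *)

Record endofunctor := Endofunctor {
  fobj :> C -> C;
  fmap : forall X Y, mor X Y -> mor (fobj X) (fobj Y);
  fmap_id : forall X, fmap (idm X) = idm (fobj X);
  fmap_comp : forall X Y Z (g : mor Y Z) (f : mor X Y),
    fmap (g \co f) = fmap g \co fmap f
}.

Definition idF : endofunctor :=
  @Endofunctor (fun X => X) (fun _ _ f => f)
    (fun _ => erefl) (fun _ _ _ _ _ => erefl).

Lemma compF_id (F G : endofunctor) X :
  fmap F (fmap G (idm X)) = idm (F (G X)).
Proof. by rewrite !fmap_id. Qed.

Lemma compF_comp (F G : endofunctor) X Y Z (g : mor Y Z) (f : mor X Y) :
  fmap F (fmap G (g \co f)) = fmap F (fmap G g) \co fmap F (fmap G f).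
Proof. by rewrite !fmap_comp. Qed.

Definition compF (F G : endofunctor) : endofunctor :=
  @Endofunctor (fun X => F (G X)) (fun _ _ f => fmap F (fmap G f))
    (compF_id F G) (compF_comp F G).

Definition linear_functor (F : endofunctor) : Prop :=
  forall X Y, linear (fun f : mor X Y => fmap F f).

Record nat_trans (F G : endofunctor) := NatTrans {
  component :> forall X, mor (F X) (G X);
  naturality : forall X Y (f : mor X Y),
    component Y \co fmap F f = fmap G f \co component X
}.

Definition nat_isomorphic (F G : endofunctor) : Prop :=
  exists a : nat_trans F G, forall X, is_iso (a X).

Definition quasi_inverse (F G : endofunctor) : Prop :=
  nat_isomorphic (compF G F) idF /\ nat_isomorphic (compF F G) idF.

Definition self_equivalence (F : endofunctor) : Prop :=
  exists G, quasi_inverse F G.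

(* The support is a set of isomorphism classes; it is represented by the
   (isomorphism-invariant) predicate on objects. *)
Definition in_support (F G : endofunctor) (a : nat_trans F G) X : Prop :=
  indecomposable X /\ a X != 0.

(* The k-dual of Hom(X, Y) is ['Hom(mor X Y, k^o)].  The last two clauses are
   naturality of [phi] in X and in Y. *)
Definition serre_functor (S : endofunctor) : Prop :=
  self_equivalence S /\
  exists phi : forall X Y, 'Hom('Hom(mor X Y, k^o), mor Y (S X)),
    [/\ forall X Y, bijective (phi X Y),
        forall X X' Y (f : mor X X') (xi : 'Hom(mor X Y, k^o)),
          phi X' Y (xi \o precomp Y f)%VF = fmap S f \co phi X Y xi
      & forall X Y Y' (g : mor Y' Y) (xi : 'Hom(mor X Y, k^o)),
          phi X Y' (xi \o postcomp X g)%VF = phi X Y xi \co g].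

(** * Triangulated structure *)

(* The shift is a self-equivalence with a chosen quasi-inverse, so that
   negative powers of it are available on objects. *)
Record triangulation := Triangulation {
  tri_additive : additive_category;
  shift : endofunctor;
  unshift : endofunctor;
  shift_unshift : quasi_inverse shift unshift;
  shift_linear : linear_functor shift;
  dist : forall X Y Z, mor X Y -> mor Y Z -> mor Z (shift X) -> Prop;
  (* TR1 *)
  dist_iso : forall X Y Z X' Y' Z'
    (f : mor X Y) (g : mor Y Z) (h : mor Z (shift X))
    (f' : mor X' Y') (g' : mor Y' Z') (h' : mor Z' (shift X'))
    (u : mor X X') (v : mor Y Y') (w : mor Z Z'),
    is_iso u -> is_iso v -> is_iso w ->
    v \co f = f' \co u -> w \co g = g' \co v ->
    fmap shift u \co h = h' \co w ->
    dist f g h -> dist f' g' h';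
  dist_id : forall X Z, is_zero Z -> dist (idm X) (0 : mor X Z) 0;
  dist_cone : forall X Y (f : mor X Y),
    exists Z (g : mor Y Z) (h : mor Z (shift X)), dist f g h;
  (* TR2 *)
  dist_rot : forall X Y Z (f : mor X Y) (g : mor Y Z) (h : mor Z (shift X)),
    dist f g h <-> dist g h (- fmap shift f);
  (* TR3 *)
  dist_fill : forall X Y Z X' Y' Z'
    (f : mor X Y) (g : mor Y Z) (h : mor Z (shift X))
    (f' : mor X' Y') (g' : mor Y' Z') (h' : mor Z' (shift X'))
    (u : mor X X') (v : mor Y Y'),
    dist f g h -> dist f' g' h' -> v \co f = f' \co u ->
    exists w : mor Z Z', w \co g = g' \co v /\ fmap shift u \co h = h' \co w;
  (* TR4, the octahedral axiom *)
  dist_octa : forall X Y Z X' Y' Z' (f : mor X Y) (g : mor Y Z)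
    (i : mor Y Z') (i' : mor Z' (shift X))
    (j : mor Z X') (j' : mor X' (shift Y))
    (l : mor Z Y') (l' : mor Y' (shift X)),
    dist f i i' -> dist g j j' -> dist (g \co f) l l' ->
    exists (a : mor Z' Y') (b : mor Y' X'),
      dist a b (fmap shift i \co j') /\
      [/\ a \co i = l \co g, l' \co a = i', b \co l = j
        & j' \co b = fmap shift f \co l']
}.

Variable T : triangulation.

Definition shiftz (r : int) (X : C) : C :=
  match r with
  | Posz n => iter n (shift T) X
  | Negz n => iter n.+1 (unshift T) X
  end.

Definition AR_triangle X Y Z
    (a : mor X Y) (b : mor Y Z) (c : mor Z (shift T X)) : Prop :=
  [/\ dist a b c, indecomposable X, indecomposable Z, c != 0
    & forall W (w : mor W Z), ~ split_epi w ->
        exists w' : mor W Y, w = b \co w'].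

(* The codomain of the third morphism of a triangle is syntactically a shift;
   a morphism with arbitrary codomain Y is compared with it along an
   isomorphism of codomains.  (Distinguished triangles being closed under
   isomorphism, this agrees with the usual notion when the shift is an
   automorphism.) *)
Definition almost_vanishing Z Y (c : mor Z Y) : Prop :=
  exists X E (a : mor X E) (b : mor E Z) (c0 : mor Z (shift T X))
    (u : mor (shift T X) Y),
    [/\ AR_triangle a b c0, is_iso u & c = u \co c0].

Definition is_shift_of (U V : C) : Prop :=
  exists r : int, isomorphic V (shiftz r U).

Definition linckelmann_type (U : C) (F : endofunctor)
    (a : nat_trans idF F) : Prop :=
  [/\ indecomposable U,
      forall V, is_shift_of U V -> almost_vanishing (a V)
    & forall V, indecomposable V -> ~ is_shift_of U V -> a V = 0].

End Categories.

(* Main.v *)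
(** Serre duality turns a functional on End(N) that kills the radical into a
  map [gamma : N -> S N] annihilated by every non-retraction into [N] and by
  every non-section out of [S N]; hence it is the third map of an
  Auslander-Reiten triangle [X -> E -> N].  Every indecomposable summand of [E]
  maps irreducibly to [N], so none is a shift of [M] when [N] is, and [alpha]
  vanishes on [E].  By naturality [alpha N] kills [E -> N] and so factors as
  [u gamma].  Since [u gamma] is nonzero, [u : S N -> F N] is a section, hence
  an isomorphism because [F N] is indecomposable. *)
From Stdlib Require Import Classical.
Require Import Defs.
From mathcomp Require Import all_boot all_order all_algebra.
Set Implicit Arguments.
Unset Strict Implicit.
Unset Printing Implicit Defensive.
Import GRing.Theory.
Local Open Scope ring_scope.

Section LinearCategories.
Variables (k : fieldType) (C : homfin_lincat k).
Implicit Types X Y Z W : C.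
Implicit Types F G : endofunctor C.

(** * Bilinearity of composition; isomorphisms and split morphisms *)

Lemma compDl X Y Z (g h : mor Y Z) (f : mor X Y) :
  (g + h) \co f = g \co f + h \co f.
Proof. by rewrite -!precompE linearD. Qed.

Lemma compDr X Y Z (g : mor Y Z) (f h : mor X Y) :
  g \co (f + h) = g \co f + g \co h.
Proof. by rewrite -!postcompE linearD. Qed.

Lemma compBl X Y Z (g h : mor Y Z) (f : mor X Y) :
  (g - h) \co f = g \co f - h \co f.
Proof. by rewrite -!precompE linearB. Qed.

Lemma compBr X Y Z (g : mor Y Z) (f h : mor X Y) :
  g \co (f - h) = g \co f - g \co h.
Proof. by rewrite -!postcompE linearB. Qed.

Lemma compNl X Y Z (g : mor Y Z) (f : mor X Y) : (- g) \co f = - (g \co f).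
Proof. by rewrite -!precompE linearN. Qed.

Lemma compNr X Y Z (g : mor Y Z) (f : mor X Y) : g \co (- f) = - (g \co f).
Proof. by rewrite -!postcompE linearN. Qed.

Lemma comp0l X Y Z (f : mor X Y) : (0 : mor Y Z) \co f = 0.
Proof. by rewrite -precompE linear0. Qed.

Lemma comp0r X Y Z (g : mor Y Z) : g \co (0 : mor X Y) = 0.
Proof. by rewrite -postcompE linear0. Qed.

Lemma compZl X Y Z a (g : mor Y Z) (f : mor X Y) :
  (a *: g) \co f = a *: (g \co f).
Proof. by rewrite -!precompE linearZ. Qed.

Lemma compZr X Y Z a (g : mor Y Z) (f : mor X Y) :
  g \co (a *: f) = a *: (g \co f).
Proof. by rewrite -!postcompE linearZ. Qed.

Lemma comp_sumr X Y Z n (g : mor Y Z) (f : 'I_n -> mor X Y) :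
  g \co (\sum_j f j) = \sum_j (g \co f j).
Proof.
by rewrite -postcompE linear_sum; apply: eq_bigr => j _; exact: postcompE.
Qed.

Lemma is_zero_from X Y (f : mor X Y) : is_zero X -> f = 0.
Proof. by move=> X0; rewrite -[f]comp_idr X0 comp0r. Qed.

Lemma is_iso_id X : is_iso (idm X).
Proof. by exists (idm X); rewrite !comp_idl. Qed.

Lemma is_iso_comp X Y Z (g : mor Y Z) (f : mor X Y) :
  is_iso g -> is_iso f -> is_iso (g \co f).
Proof.
move=> [g' [g'g gg']] [f' [f'f ff']]; exists (f' \co g'); split.
  by rewrite comp_assoc -(comp_assoc f') g'g comp_idr.
by rewrite comp_assoc -(comp_assoc g) ff' comp_idr.
Qed.

Lemma is_iso_split X Y (f : mor X Y) : split_mono f -> split_epi f -> is_iso f.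
Proof.
move=> [g gf] [h fh]; exists g; split=> //.
by rewrite -[g]comp_idr -fh (comp_assoc g) gf comp_idl.
Qed.

Lemma isomorphic_refl X : isomorphic X X.
Proof. by exists (idm X); apply: is_iso_id. Qed.

Lemma isomorphic_sym X Y : isomorphic X Y -> isomorphic Y X.
Proof. by case=> f [g [gf fg]]; exists g, f. Qed.

Lemma isomorphic_trans X Y Z :
  isomorphic X Y -> isomorphic Y Z -> isomorphic X Z.
Proof.
by move=> [f isof] [g isog]; exists (g \co f); apply: is_iso_comp.
Qed.

Lemma split_mono_compr X Y Z (g : mor Y Z) (f : mor X Y) :
  split_mono (g \co f) -> split_mono f.
Proof. by case=> h hgf; exists (h \co g); rewrite -comp_assoc. Qed.

Lemma split_epi_compl X Y Z (g : mor Y Z) (f : mor X Y) :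
  split_epi (g \co f) -> split_epi g.
Proof. by case=> h gfh; exists (f \co h); rewrite comp_assoc. Qed.

Lemma is_iso_split_mono X Y (f : mor X Y) : is_iso f -> split_mono f.
Proof. by case=> g [gf _]; exists g. Qed.

Lemma is_iso_split_epi X Y (f : mor X Y) : is_iso f -> split_epi f.
Proof. by case=> g [_ fg]; exists g. Qed.

(** * Local endomorphism rings and indecomposable objects *)

Lemma local_idem X (e : mor X X) :
  local_end X -> e \co e = e -> e = 0 \/ e = idm X.
Proof.
move=> [_ locX] ee.
have /locX[[g [ge _]]|[g [ge _]]] : is_iso (e + (idm X - e)).
- by rewrite addrC subrK; apply: is_iso_id.
- by right; rewrite -[e]comp_idl -ge -comp_assoc ee.
left; rewrite -[e]comp_idl -ge -comp_assoc compBl comp_idl ee subrr comp0r //.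
Qed.

(** With [g] a retraction of [f], [f \co g] is an idempotent of the local ring End(Y); were it 0,
    [idm X] would vanish too. *)
Lemma local_split_mono X Y (f : mor X Y) :
  ~ is_zero X -> local_end Y -> split_mono f -> is_iso f.
Proof.
move=> nzX locY [g gf]; exists g; split=> //.
case: (@local_idem Y (f \co g) locY) => //.
  by rewrite comp_assoc -(comp_assoc f) gf comp_idr.
move=> fg0; case: nzX; rewrite /is_zero -gf -[f]comp_idr -gf !comp_assoc.
by rewrite -(comp_assoc g f g) fg0 comp0r comp0l.
Qed.

Lemma local_isomorphic X Y : isomorphic X Y -> local_end X -> local_end Y.
Proof.
move=> [f [g [gf fg]]] [nzX locX]; split=> [Y0|a b].
  by apply: nzX; rewrite /is_zero -gf (is_zero_from g Y0) comp0l.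
have isof : is_iso f by exists g.
have isog : is_iso g by exists f.
have conj c : is_iso (g \co c \co f) -> is_iso c.
  have {2}-> : c = f \co (g \co c \co f) \co g.
    by rewrite !comp_assoc fg comp_idl -comp_assoc fg comp_idr.
  by move=> isoc; do 2?apply: is_iso_comp.
move=> isoab; have := is_iso_comp (is_iso_comp isog isoab) isof.
by rewrite compDr compDl => /locX[]/conj; [left|right].
Qed.

(** One of [iA \co pA], [iB \co pB] is invertible; it is orthogonal to the other summand, which
    therefore vanishes. *)
Lemma local_indecomposable X : local_end X -> indecomposable X.
Proof.
move=> [nzX locX]; split=> // A B iA iB pA pB [pAiA pBiB pAiB pBiA sum1].
have /locX[[g [_ ag]]|[g [_ ag]]] : is_iso (iA \co pA + iB \co pB).
- by rewrite sum1; apply: is_iso_id.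
- right; rewrite /is_zero -pBiB -[pB]comp_idr -ag !comp_assoc pBiA.
  by rewrite !comp0l.
left; rewrite /is_zero -pAiA -[pA]comp_idr -ag !comp_assoc pAiB.
by rewrite !comp0l.
Qed.

(** Iterated biproducts collect the summands indexed by [s] into one object. The orthogonality
    clauses outside [s] carry the induction. *)
Lemma split_sub_biproduct X n (N : 'I_n -> C)
    (i : forall j, mor (N j) X) (p : forall j, mor X (N j)) (s : seq 'I_n) :
  additive_category C ->
  (forall j, p j \co i j = idm (N j)) ->
  (forall j l, j != l -> p j \co i l = 0) -> uniq s ->
  exists B (iB : mor B X) (pB : mor X B),
    [/\ pB \co iB = idm B, forall j, j \notin s -> p j \co iB = 0,
        forall j, j \notin s -> pB \co i j = 0
      & iB \co pB = \sum_(j <- s) (i j \co p j)].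
Proof.
move=> [[Z Z0] biprod] pi1 pi0; elim: s => [|j s IHs] /=.
  exists Z, 0, 0; split=> [|j _|j _|].
  - by rewrite Z0 comp0l.
  - exact: comp0r.
  - exact: comp0l.
  - by rewrite big_nil comp0l.
case/andP=> js /IHs[B [iB [pB [pBiB piB pBi iBpB]]]].
have [D [iA [iB' [pA [pB' [pAiA pBiB' pAiB pBiA sum1]]]]]] := biprod (N j) B.
exists D, (i j \co pA + iB \co pB'), (iA \co p j + iB' \co pB); split.
- rewrite !(compDl, compDr) !comp_assoc -!(comp_assoc _ (p j)).
  rewrite -!(comp_assoc _ pB) pi1 piB // pBi // pBiB.
  by rewrite !comp0r !comp0l !comp_idr addr0 add0r.
- move=> l; rewrite inE negb_or => /andP[lj ls].
  by rewrite compDr !comp_assoc pi0 // piB // !comp0l addr0.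
- move=> l; rewrite inE negb_or eq_sym => /andP[lj ls].
  by rewrite compDl -!comp_assoc pi0 // pBi // !comp0r addr0.
rewrite big_cons -iBpB !(compDl, compDr) !comp_assoc -!(comp_assoc _ pA).
by rewrite -!(comp_assoc _ pB') pAiA pAiB pBiA pBiB' !comp0r !comp0l !comp_idr
  addr0 add0r.
Qed.

(** All Krull-Schmidt summands but the first are grouped into one complement [B]. The first is
    nonzero, so indecomposability forces [B] to be zero and [X] is isomorphic to a local object. *)
Lemma indecomposable_local X : additive_category C -> krull_schmidt C ->
  indecomposable X -> local_end X.
Proof.
move=> addC HKS [nzX indX]; have [[|n] [N [i [p [locN pi1 pi0 sum1]]]]] := HKS X.
  by case: nzX; rewrite /is_zero -sum1 big_ord0.
have [|B [iB [pB [pBiB piB pBi iBpB]]]] :=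
  @split_sub_biproduct X n.+1 N i p (rem ord0 (index_enum 'I_n.+1)) addC pi1 pi0.
  by rewrite rem_uniq ?index_enum_uniq.
have not_in : ord0 \notin rem ord0 (index_enum 'I_n.+1).
  by rewrite mem_rem_uniq ?index_enum_uniq // !inE eqxx.
have sumip : i ord0 \co p ord0 + iB \co pB = idm X.
  by rewrite iBpB -sum1 [RHS](big_rem ord0) ?mem_index_enum.
have [|B0] := indX _ _ _ _ _ _ (And5 (pi1 ord0) pBiB (piB _ not_in)
  (pBi _ not_in) sumip); first by case: (locN ord0).
apply: local_isomorphic (locN ord0); exists (i ord0), (p ord0); split=> //.
by rewrite -sumip (is_zero_from iB B0) comp0l addr0.
Qed.

(** * Linear functionals and the radical *)

(** Since [v - projv U v] is nonzero, some coordinate of it is nonzero; that coordinate composed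
    with [1 - projv U] is the functional. *)
Lemma functional_separation (V : vectType k) (U : {vspace V}) (v : V) :
  v \notin U ->
  exists2 xi : 'Hom(V, k^o), xi v != 0 & forall u, u \in U -> xi u = 0.
Proof.
move=> vU; pose w := v - projv U v.
have w0 : w != 0.
  by rewrite subr_eq0; apply: contraNneq vU => ->; apply: memv_proj.
have [i xi0] : exists i, coord (vbasis {:V}) i w != 0.
  apply/existsP; apply: contra_neqT w0; rewrite negb_exists => /forallP co0.
  rewrite (coord_vbasis (memvf w)) big1 // => i _.
  by rewrite (eqP (negbNE (co0 i))) scale0r.
exists (linfun (coord (vbasis {:V}) i : V -> k^o) \o (\1 - projv U))%VF.
  by rewrite !lfunE /= !lfunE /= id_lfunE opp_lfunE.
by move=> u uU;
  rewrite !lfunE /= !lfunE /= id_lfunE opp_lfunE /= projv_id // subrr linear0.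
Qed.

(* A subspace of maximal dimension among those without isomorphisms is the
   whole radical, because in a local endomorphism ring the radical is closed
   under sums. *)
Lemma radical_functional X : local_end X ->
  exists2 xi : 'Hom(mor X X, k^o), xi != 0 & forall f, ~ is_iso f -> xi f = 0.
Proof.
move=> [nzX locX].
pose P (U : {vspace mor X X}) := forall f, f \in U -> ~ is_iso f.
have [U PU maxU] : exists2 U, P U & forall V, P V -> (\dim V <= \dim U)%N.
  have bound (U : {vspace mor X X}) : (\dim U <= \dim {: mor X X})%N.
    exact: dimvS (subvf U).
  have P0 : P 0%VS.
    move=> f; rewrite memv0 => /eqP-> [g [g0 _]]; apply: nzX.
    by rewrite /is_zero -g0 comp0r.
  suff [m] : exists m, (exists2 U, P U & \dim U = m) /\
      forall V, P V -> (\dim V <= m)%N.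
    by case=> -[U PU <-] maxU; exists U.
  (* Without a maximum, the dimensions of admissible subspaces would exceed that of End(X). *)
  apply: NNPP => nomax.
  have big m : exists2 U, P U & (m <= \dim U)%N.
    elim: m => [|m [U PU leU]]; first by exists 0%VS.
    apply: NNPP => nolarger; apply: nomax; exists m; split.
      exists U => //; apply/eqP; rewrite eqn_leq leU andbT leqNgt.
      by apply/negP => ltU; apply: nolarger; exists U.
    move=> V PV; rewrite leqNgt; apply/negP => ltV.
    by apply: nolarger; exists V.
  have [U _] := big (\dim {: mor X X}).+1.
  by rewrite leqNgt ltnS bound.
have radU f : ~ is_iso f -> f \in U.
  move=> nisof; have : P (U + <[f]>)%VS.
    move=> _ /memv_addP[u uU [_ /vlineP[a ->] ->]] /locX[]; first exact: PU.
    have [->|a0] := eqVneq a 0; first by rewrite scale0r; apply: PU (mem0v _).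
    case=> g [gaf afg]; apply: nisof; exists (a *: g).
    by split; [rewrite compZl -compZr | rewrite compZr -compZl].
  move=> /maxU; rewrite (geq_leqif (dimv_leqif_sup (addvSl U <[f]>))).
  by move/subvP; apply; rewrite -[X in X \in _]add0r memv_add ?mem0v ?memv_line.
have [|xi xi1 xiU] := @functional_separation (mor X X) U (idm X).
  by apply/negP => /PU; apply; apply: is_iso_id.
by exists xi => [|f /radU /xiU //]; apply: contraNneq xi1 => ->; rewrite zero_lfunE.
Qed.

(** * Transport along isomorphisms and self-equivalences *)

Lemma irreducible_iso X X' Y Y' (u : mor Y Y') (f : mor X Y) (v : mor X' X) :
  is_iso u -> is_iso v -> irreducible f -> irreducible (u \co f \co v).
Proof.
move=> [u' [u'u uu']] [v' [v'v vv']] [nmono nepi fact]; split.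
- move=> [g gufv]; apply: nmono; exists (v \co g \co u).
  have -> : v \co g \co u \co f = v \co (g \co (u \co f \co v)) \co v'.
    by rewrite !comp_assoc -(comp_assoc _ v) vv' comp_idr.
  by rewrite gufv comp_idr.
- move=> [g ufvg]; apply: nepi; exists (v \co g \co u).
  have -> : f \co (v \co g \co u) = u' \co (u \co f \co v \co g) \co u.
    by rewrite !comp_assoc u'u comp_idl.
  by rewrite ufvg comp_idr.
move=> W g h ufv; have [] := fact W (g \co v') (u' \co h).
- rewrite comp_assoc -(comp_assoc u') -ufv !comp_assoc u'u comp_idl.
  by rewrite -comp_assoc vv' comp_idr.
- move=> [t tgv]; left; exists (v' \co t).
  rewrite -[v' \co t \co g]comp_idr -v'v comp_assoc -(comp_assoc v' t).
  by rewrite -(comp_assoc v') -(comp_assoc t) tgv comp_idr.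
move=> [t uht]; right; exists (t \co u').
rewrite comp_assoc -[h \co t]comp_idl -uu' -(comp_assoc u).
by rewrite (comp_assoc u' h t) uht comp_idr.
Qed.

Definition additive_functor (F : endofunctor C) : Prop :=
  forall X Y (f g : mor X Y), fmap F (f + g) = fmap F f + fmap F g.

Lemma additive0 F X Y : additive_functor F -> fmap F (0 : mor X Y) = 0.
Proof.
by move=> addF; apply: (addrI (fmap F 0)); rewrite -addF !addr0.
Qed.

Lemma additiveN F X Y (f : mor X Y) :
  additive_functor F -> fmap F (- f) = - fmap F f.
Proof.
by move=> addF; apply/eqP; rewrite -addr_eq0 -addF addNr additive0.
Qed.

Lemma linear_additive F : linear_functor F -> additive_functor F.
Proof. by move=> linF X Y f g; have := linF X Y 1 f g; rewrite !scale1r. Qed.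

Lemma fmap_iso (F : endofunctor C) X Y (f : mor X Y) :
  is_iso f -> is_iso (fmap F f).
Proof.
by case=> g [gf fg]; exists (fmap F g); rewrite -!fmap_comp gf fg !fmap_id.
Qed.

Lemma fmap_isomorphic (F : endofunctor C) X Y :
  isomorphic X Y -> isomorphic (F X) (F Y).
Proof. by case=> f isof; exists (fmap F f); apply: fmap_iso. Qed.

Lemma quasi_inverse_sym (F G : endofunctor C) :
  quasi_inverse F G -> quasi_inverse G F.
Proof. by case. Qed.

Lemma quasi_inverse_counit F G X : quasi_inverse F G -> isomorphic (F (G X)) X.
Proof. by move=> [_ [a isoa]]; exists (a X); apply: isoa. Qed.

Lemma quasi_inverse_faithful F G X Y :
  quasi_inverse F G -> injective (@fmap k C F X Y).
Proof.
move=> [[a isoa] _] f g Ffg.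
have: f \co a X = g \co a X.
  have := naturality a g; have := naturality a f; rewrite /= Ffg.
  by move=> <- <-.
have [b [_ ab]] := isoa X => fa_ga.
by rewrite -[f]comp_idr -ab comp_assoc fa_ga -comp_assoc ab comp_idr.
Qed.

Lemma quasi_inverse_full F G X Y (h : mor (F X) (F Y)) :
  quasi_inverse F G -> exists f, fmap F f = h.
Proof.
move=> FG; have [[a isoa] _] := FG.
have [b [ba ab]] := isoa X; have [b' [b'a ab']] := isoa Y.
exists (a Y \co fmap G h \co b).
(* Equality is tested after the faithful [G], where naturality of [a] at the candidate leaves only
   the isomorphism [a Y] to cancel. *)
apply: (quasi_inverse_faithful (quasi_inverse_sym FG)).
have := naturality a (a Y \co fmap G h \co b) => /=.
rewrite -(comp_assoc _ b) ba comp_idr => /(congr1 (compm b')).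
by rewrite !comp_assoc b'a !comp_idl.
Qed.

Lemma self_equivalence_faithful F X Y :
  self_equivalence F -> injective (@fmap k C F X Y).
Proof. by case=> G; apply: quasi_inverse_faithful. Qed.

Lemma self_equivalence_full F X Y (h : mor (F X) (F Y)) :
  self_equivalence F -> exists f, fmap F f = h.
Proof. by case=> G; apply: quasi_inverse_full. Qed.

Lemma self_equivalence_surj F X :
  self_equivalence F -> exists Y, isomorphic (F Y) X.
Proof. by case=> G FG; exists (G X); apply: quasi_inverse_counit FG. Qed.

Lemma fmap_split_mono F X Y (f : mor X Y) :
  self_equivalence F -> split_mono (fmap F f) -> split_mono f.
Proof.
move=> eqF [h hFf]; have [g Fg] := self_equivalence_full h eqF; exists g.
by apply: (self_equivalence_faithful eqF); rewrite fmap_comp Fg fmap_id.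
Qed.

Lemma fmap_split_epi F X Y (f : mor X Y) :
  self_equivalence F -> split_epi (fmap F f) -> split_epi f.
Proof.
move=> eqF [h Ffh]; have [g Fg] := self_equivalence_full h eqF; exists g.
by apply: (self_equivalence_faithful eqF); rewrite fmap_comp Fg fmap_id.
Qed.

Lemma fmap_reflect_iso F X Y (f : mor X Y) :
  self_equivalence F -> is_iso (fmap F f) -> is_iso f.
Proof.
move=> eqF isoFf; apply: is_iso_split.
  exact: fmap_split_mono eqF (is_iso_split_mono isoFf).
exact: fmap_split_epi eqF (is_iso_split_epi isoFf).
Qed.

(** The middle object of a factorization of [fmap F f] is replaced by an isomorphic [F W']; fullness
    and faithfulness then lift the factorization to one of [f]. *)
Lemma fmap_irreducible F X Y (f : mor X Y) :
  self_equivalence F -> irreducible f -> irreducible (fmap F f).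
Proof.
move=> eqF [nmono nepi fact]; split=> [/(fmap_split_mono eqF)//||W g h Ff].
  by move/(fmap_split_epi eqF).
have [W' [c [c' [c'c cc']]]] := self_equivalence_surj W eqF.
have [g' Fg'] := self_equivalence_full (c' \co g) eqF.
have [h' Fh'] := self_equivalence_full (h \co c) eqF.
have [|[t tg]|[t ht]] := fact W' g' h'.
- apply: (self_equivalence_faithful eqF); rewrite fmap_comp Fg' Fh' Ff.
  by rewrite comp_assoc -(comp_assoc h) cc' comp_idr.
- left; exists (fmap F t \co c').
  by rewrite -comp_assoc -Fg' -fmap_comp tg fmap_id.
right; exists (c \co fmap F t).
by rewrite comp_assoc -Fh' -fmap_comp ht fmap_id.
Qed.

Lemma local_fmap F X : self_equivalence F -> additive_functor F ->
  local_end X -> local_end (F X).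
Proof.
move=> eqF addF [nzX locX]; split=> [FX0|f g].
  apply: nzX; apply: (self_equivalence_faithful eqF).
  by rewrite fmap_id additive0.
have [f' <-] := self_equivalence_full f eqF.
have [g' <-] := self_equivalence_full g eqF.
by rewrite -addF => /(fmap_reflect_iso eqF)/locX[]/(fmap_iso F); [left|right].
Qed.

Lemma fmap_local F X : self_equivalence F -> additive_functor F ->
  local_end (F X) -> local_end X.
Proof.
move=> eqF addF [nzFX locFX]; split=> [X0|f g].
  by apply: nzFX; rewrite /is_zero -fmap_id X0 additive0.
by move=> /(fmap_iso F); rewrite addF => /locFX[]/(fmap_reflect_iso eqF);
  [left|right].
Qed.

(** * Consequences of Serre duality *)

Section Serre.
Variables (S : endofunctor C) (HS : serre_functor S).

(** Additivity is not part of the definition of a Serre functor. It follows because naturality of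
    [phi], evaluated at the preimage of [idm (S X)], writes [fmap S h] as an expression linear in
    [h]. *)
Lemma serre_additive : additive_functor S.
Proof.
have [_ [phi [bij_phi phiX _]]] := HS => X X' f g.
have [psi _ phiK] := bij_phi X (S X).
have fmapE (h : mor X X') :
    fmap S h = phi X' (S X) (psi (idm (S X)) \o precomp (S X) h)%VF.
  by rewrite phiX phiK comp_idr.
rewrite !fmapE -linearD /=; congr (phi _ _ _); apply/lfunP => h.
by rewrite add_lfunE !comp_lfunE !precompE compDr linearD.
Qed.

(** Take [gamma] to be [phi xi] for a nonzero [xi] killing the non-isomorphisms of [N]. Then
    [gamma \co w] corresponds to the functional sending [g] to [xi (w \co g)], and an invertible
    [w \co g] would make [w] split epi. The last clause is dual, with [xi (g \co f)]. *)
Lemma serre_socle N : local_end N ->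
  exists gamma : mor N (S N),
    [/\ gamma != 0,
        forall W (w : mor W N), ~ split_epi w -> gamma \co w = 0
      & forall W (u : mor (S N) W), u \co gamma != 0 -> split_mono u].
Proof.
move=> locN; have [eqS [phi [bij_phi phiX phiY]]] := HS.
have [xi xi0 xi_rad] := radical_functional locN.
have phi_inj X Y : injective (phi X Y) by apply: bij_inj.
exists (phi N N xi); split=> [|W w nepi|W u u_gamma].
- by apply: contra_neq xi0 => phi0; apply: (phi_inj N N); rewrite phi0 linear0.
- rewrite -phiY -[RHS](linear0 (phi N W)); congr (phi _ _ _); apply/lfunP => g.
  rewrite comp_lfunE postcompE zero_lfunE; apply: xi_rad => /is_iso_split_epi.
  by move/split_epi_compl.
(* Up to an isomorphism of its codomain, [u] is [fmap S f], so naturality of [phi] in its first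
   argument applies. *)
have [W' [c [c' [c'c cc']]]] := self_equivalence_surj W eqS.
have [f Sf] := self_equivalence_full (c' \co u) eqS.
suff: split_mono (c' \co u) by apply: split_mono_compr.
have: phi W' N (xi \o precomp N f)%VF != 0.
  apply: contra_neq u_gamma; rewrite phiX Sf => c'u_gamma0.
  by rewrite -[u]comp_idl -cc' -!comp_assoc (comp_assoc c') c'u_gamma0 comp0r.
move/eqP => phi_neq; apply: NNPP => nmono; apply: phi_neq.
rewrite -[RHS](linear0 (phi W' N)).
congr (phi _ _ _); apply/lfunP => g; rewrite comp_lfunE precompE zero_lfunE.
apply: xi_rad => /is_iso_split_mono/split_mono_compr[h hf]; apply: nmono.
by exists (fmap S h); rewrite -Sf -fmap_comp hf fmap_id.
Qed.

End Serre.

(** * Exactness properties of distinguished triangles *)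

Section Triangles.
Variable T : triangulation C.

Lemma shift_additive : additive_functor (shift T).
Proof. exact/linear_additive/shift_linear. Qed.

Lemma shift_equivalence : self_equivalence (shift T).
Proof. by exists (unshift T); apply: shift_unshift. Qed.

Lemma unshift_equivalence : self_equivalence (unshift T).
Proof. by exists (shift T); apply/quasi_inverse_sym/shift_unshift. Qed.

Lemma shift_unshift_iso X : isomorphic (shift T (unshift T X)) X.
Proof. exact/quasi_inverse_counit/shift_unshift. Qed.

Lemma unshift_shift_iso X : isomorphic (unshift T (shift T X)) X.
Proof. exact/quasi_inverse_counit/quasi_inverse_sym/shift_unshift. Qed.

Lemma shift_zero X : is_zero X -> is_zero (shift T X).
Proof.
by move=> X0; rewrite /is_zero -fmap_id X0 (additive0 _ _ shift_additive).
Qed.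

(** The triangle on [idm X] maps to the given one through [idm X] and [f], so [g \co f] factors
    through a zero object. *)
Lemma dist_comp0 X Y Z (f : mor X Y) (g : mor Y Z) (h : mor Z (shift T X)) :
  dist f g h -> g \co f = 0.
Proof.
have [[Z0 zZ0] _] := tri_additive T.
move=> fgh.
have [w [<- _]] := dist_fill (dist_id T X zZ0) fgh (erefl (f \co idm X)).
exact: comp0r.
Qed.

(** TR3 supplies only a third map, so both the given triangle and the one on [idm W] are rotated
    first. The filler goes from [shift T W] to [shift T X] and is unshifted by fullness; the two
    signs cancel. *)
Lemma dist_weak_kernel X Y Z W (f : mor X Y) (g : mor Y Z)
    (h : mor Z (shift T X)) (w : mor W Y) :
  dist f g h -> g \co w = 0 -> exists v, w = f \co v.
Proof.
have [[Z0 zZ0] _] := tri_additive T => /dist_rot fgh gw0.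
have /dist_rot dW := dist_id T W zZ0.
have sq : (0 : mor Z0 Z) \co (0 : mor W Z0) = g \co w by rewrite comp0l gw0.
have [w' [_ ww']] := dist_fill dW fgh sq.
have [v Sv] := self_equivalence_full w' shift_equivalence.
exists v; apply: (self_equivalence_faithful shift_equivalence).
move: ww'; rewrite fmap_comp Sv fmap_id compNr compNl comp_idr.
exact: oppr_inj.
Qed.

Lemma dist_weak_cokernel X Y Z V (f : mor X Y) (g : mor Y Z)
    (h : mor Z (shift T X)) (t : mor Y V) :
  dist f g h -> t \co f = 0 -> exists v, t = v \co g.
Proof.
have [[Z0 zZ0] _] := tri_additive T => fgh tf0.
have dV : dist (0 : mor Z0 V) (idm V) (0 : mor V (shift T Z0)).
  apply/dist_rot; rewrite (additive0 _ _ shift_additive) oppr0.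
  exact/dist_id/shift_zero.
have sq : t \co f = (0 : mor Z0 V) \co (0 : mor X Z0) by rewrite comp0l.
by have [w [wg _]] := dist_fill fgh dV sq; exists w; rewrite wg comp_idl.
Qed.

(** A cone of [c] is rotated back twice, after its vertex is replaced by a shift. *)
Lemma dist_third X Z (c : mor Z (shift T X)) :
  exists E (a : mor X E) (b : mor E Z), dist a b c.
Proof.
have [W [g [h dc]]] := dist_cone T c.
have [d [d' [d'd dd']]] := shift_unshift_iso W.
have [a1 Sa] := self_equivalence_full (d' \co g) shift_equivalence.
have [b1 Sb] := self_equivalence_full (h \co d) shift_equivalence.
(* These signs cancel the ones introduced by the two rotations. *)
exists (unshift T W), (- a1), (- b1); apply/dist_rot/dist_rot.
rewrite !(additiveN _ shift_additive) !opprK Sa Sb.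
have isod' : is_iso d' by exists d.
apply: (dist_iso (is_iso_id Z) (is_iso_id (shift T X)) isod' _ _ _ dc).
- by rewrite comp_idl comp_idr.
- by rewrite comp_idr.
by rewrite fmap_id comp_idl -comp_assoc dd' comp_idr.
Qed.

(** Consecutive maps compose to 0, so [fmap (shift T) a] kills [c], and it has a left inverse. *)
Lemma dist_section X Y Z (a : mor X Y) (b : mor Y Z) (c : mor Z (shift T X)) :
  dist a b c -> split_mono a -> c = 0.
Proof.
move=> /dist_rot/dist_rot/dist_comp0 ac0 [r ra].
rewrite -[c]comp_idl -fmap_id -ra fmap_comp -comp_assoc.
by move: ac0; rewrite compNl => /eqP; rewrite oppr_eq0 => /eqP->; rewrite comp0r.
Qed.

(* Suppose b i = h g with h not a retraction.  Then h = b h', so i - h' g = a v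
   and p h' g = 1 - p a v; in the local ring End(Y) either this is invertible,
   and g is a section, or p a v is, and a would be a section. *)
Lemma AR_summand_irreducible X E Z Y (a : mor X E) (b : mor E Z)
    (c : mor Z (shift T X)) (i : mor Y E) (p : mor E Y) :
  local_end X -> local_end Z -> local_end Y -> AR_triangle a b c ->
  p \co i = idm Y -> irreducible (b \co i).
Proof.
move=> locX locZ locY [dabc _ _ nzc factb] pi1.
have nepib : ~ split_epi b.
  move=> [s bs]; case/eqP: nzc; move/dist_rot/dist_comp0: dabc => cb.
  by rewrite -[c]comp_idr -bs comp_assoc cb comp0l.
have nepi : ~ split_epi (b \co i) by move/split_epi_compl.
split=> // [mono|W g h fact].
  by apply/nepi/is_iso_split_epi/local_split_mono => //; case: locY.
have [|nepih] := classic (split_epi h); [by right | left].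
have [h' defh] := factb _ _ nepih.
have [|v iv] := @dist_weak_kernel _ _ _ _ a b c (i - h' \co g) dabc.
  by rewrite compBr comp_assoc -defh fact subrr.
have [|/is_iso_split_mono|isopav] := (proj2 locY) (p \co h' \co g) (p \co a \co v).
- rewrite -!comp_assoc -iv compBr pi1 addrC subrK; exact: is_iso_id.
- by move/split_mono_compr.
case/eqP: nzc; apply: dist_section dabc _.
(* Here [v] is a section into the local object [X], hence invertible; cancelling it leaves [p \co a]
   invertible. *)
have isov : is_iso v.
  apply: local_split_mono => //; first by case: locY.
  exact/split_mono_compr/is_iso_split_mono/isopav.
have [v' [v'v vv']] := isov.
apply: (@split_mono_compr _ _ _ p); apply: is_iso_split_mono.
rewrite -[p \co a]comp_idr -vv' comp_assoc; apply: is_iso_comp => //.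
by exists v.
Qed.

(** * The shift orbit of an object *)

Lemma is_shift_of_iso U V W :
  isomorphic V W -> is_shift_of T U V -> is_shift_of T U W.
Proof.
move=> /isomorphic_sym WV [r VU].
by exists r; apply: isomorphic_trans WV VU.
Qed.

Lemma is_shift_of_shiftz U r : is_shift_of T U (shiftz T r U).
Proof. by exists r; apply: isomorphic_refl. Qed.

Lemma is_shift_of_shift U V : is_shift_of T U V -> is_shift_of T U (shift T V).
Proof.
move=> [r /(fmap_isomorphic (shift T))/isomorphic_sym SVU].
(* [Negz n] stands for -(n+1): shifting [Negz 0] lands at 0, and [Negz n.+1] at [Negz n]. *)
apply: is_shift_of_iso SVU _; case: r => [n|[|n]].
- exact: (is_shift_of_shiftz U n.+1).
- by exists 0; apply: shift_unshift_iso.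
- by exists (Negz n); apply: shift_unshift_iso.
Qed.

Lemma is_shift_of_unshift U V :
  is_shift_of T U V -> is_shift_of T U (unshift T V).
Proof.
move=> [r /(fmap_isomorphic (unshift T))/isomorphic_sym UVU].
apply: is_shift_of_iso UVU _; case: r => [[|n]|n].
- exact: (is_shift_of_shiftz U (Negz 0)).
- by exists n; apply: unshift_shift_iso.
- exact: (is_shift_of_shiftz U (Negz n.+1)).
Qed.

Lemma local_shift_of U V : is_shift_of T U V -> local_end U -> local_end V.
Proof.
have unshift_local X : local_end X -> local_end (unshift T X).
  move=> locX; apply: (fmap_local shift_equivalence shift_additive).
  exact: local_isomorphic (isomorphic_sym (shift_unshift_iso X)) locX.
move=> [r /isomorphic_sym VU] locU; apply: local_isomorphic VU _.
case: r => n /=; last by elim: n => [|n] /=; apply: (unshift_local _).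
elim: n => //= n.
exact: local_fmap shift_equivalence shift_additive.
Qed.

(** The hypothesis concerns only maps into [M] itself. Applying [unshift] or [shift] brings the
    codomain to [M] one step at a time, keeping the domain in the orbit and the map irreducible. *)
Lemma no_irreducible_between_shifts M :
  (forall (r : int) (f : mor (shiftz T r M) M), ~ irreducible f) ->
  forall V W (f : mor V W),
    is_shift_of T M V -> is_shift_of T M W -> ~ irreducible f.
Proof.
move=> Hirr V W f MV [r [u isou]].
have comp_left X Y Y' (h : mor Y Y') (g : mor X Y) :
    is_iso h -> irreducible g -> irreducible (h \co g).
  move=> isoh irrg; rewrite -[h \co g]comp_idr.
  exact: irreducible_iso isoh (is_iso_id X) irrg.
move=> /(comp_left _ _ _ _ _ isou); move: (u \co f) => {u isou W}f.
suff base V' (g : mor V' M) : is_shift_of T M V' -> ~ irreducible g.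
  case: r f => n f.
    elim: n V MV f => [|n IHn] V MV f; first exact: base.
    move=> /(fmap_irreducible unshift_equivalence).
    have [h isoh] := unshift_shift_iso (iter n (shift T) M).
    by move=> /(comp_left _ _ _ _ _ isoh); apply/IHn/is_shift_of_unshift.
  move: f; rewrite /shiftz; elim: n.+1 V MV => [|m IHm] V' MV' f.
    exact: base.
  move=> /(fmap_irreducible shift_equivalence).
  have [h isoh] := shift_unshift_iso (iter m (unshift T) M).
  by move=> /(comp_left _ _ _ _ _ isoh); apply/IHm/is_shift_of_shift.
move=> [s /isomorphic_sym[v isov]].
by move=> /(irreducible_iso (is_iso_id M) isov); apply: Hirr.
Qed.

(** * Auslander-Reiten triangles and components of natural transformations *)

(** The map of [serre_socle] is carried to the codomain [shift T (unshift T (S N))] and completed to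
    a triangle. A non-retraction [w] is killed by it, hence factors through [b] by the weak kernel
    property. *)
Lemma AR_triangle_exists S N : serre_functor S -> local_end N ->
  exists X E (a : mor X E) (b : mor E N) (c : mor N (shift T X)),
    [/\ AR_triangle a b c, local_end X, isomorphic (shift T X) (S N)
      & forall W (u : mor (shift T X) W), u \co c != 0 -> split_mono u].
Proof.
move=> HS locN; have [gamma [nz_gamma nepi0 socle]] := serre_socle HS locN.
have [e [e' [e'e ee']]] := shift_unshift_iso (S N).
have [E [a [b dab]]] := dist_third (e' \co gamma).
have locX : local_end (unshift T (S N)).
  apply: (fmap_local shift_equivalence shift_additive).
  apply: (@local_isomorphic (S N)); first by exists e', e.
  by apply: local_fmap locN; [case: HS | apply: serre_additive].
exists (unshift T (S N)), E, a, b, (e' \co gamma); split=> //.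
- split=> //; [exact: local_indecomposable|exact: local_indecomposable| |].
    apply: contra_neq nz_gamma => e'g0.
    by rewrite -[gamma]comp_idl -ee' -comp_assoc e'g0 comp0r.
  move=> W w /nepi0 gw0; move/dist_rot: dab => /dist_weak_kernel; apply.
  by rewrite -comp_assoc gw0 comp0r.
- by exists e, e'.
move=> W u; rewrite comp_assoc => /socle[t tue']; exists (e' \co t).
by rewrite -[RHS]e'e -[in RHS](comp_idl e) -tue' -[LHS]comp_idr -e'e !comp_assoc.
Qed.

Lemma almost_vanishing_component S F (alpha : nat_trans (idF C) F) N :
  krull_schmidt C -> serre_functor S -> local_end N -> local_end (F N) ->
  alpha N != 0 ->
  (forall Y (f : mor Y N), local_end Y -> irreducible f -> alpha Y = 0) ->
  isomorphic (F N) (S N) /\ almost_vanishing T (alpha N).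
Proof.
move=> HKS HS locN locFN nz_alpha alpha0.
have [X [E [a [b [c [AR locX XSN socle]]]]]] := AR_triangle_exists HS locN.
have dabc : dist a b c by case: AR.
(* This is checked on each local summand of [E]: its map to [N] is irreducible, so [alpha] vanishes
   on it, and naturality applies. *)
have alpha_b : alpha N \co b = 0.
  have [n [Y [i [p [locY pi1 _ sum1]]]]] := HKS E.
  rewrite -[b]comp_idr -sum1 !comp_sumr big1 // => j _.
  have irr := AR_summand_irreducible locX locN (locY j) AR (pi1 j).
  have /= nat := naturality alpha (b \co i j).
  by rewrite !comp_assoc -(comp_assoc _ b) nat (alpha0 _ _ (locY j) irr)
    comp0r comp0l.
have [u def_alpha] := dist_weak_cokernel (proj1 (dist_rot _ _ _) dabc) alpha_b.
(* As [u \co c] is [alpha N], which is nonzero, [u] is a section; its codomain [F N] is local. *)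
have isou : is_iso u.
  apply: local_split_mono => //; last by apply: socle; rewrite -def_alpha.
  exact: (local_fmap shift_equivalence shift_additive locX).1.
split; last by exists X, E, a, b, c, u.
by apply: isomorphic_trans XSN; apply: isomorphic_sym; exists u.
Qed.

End Triangles.

End LinearCategories.

Theorem proposition3p3 (k : closedFieldType) (C : homfin_lincat k)
  (T : triangulation C) (HKS : krull_schmidt C)
  (S : endofunctor C) (HS : serre_functor S)
  (M : C) (HM : indecomposable M)
  (Hirr : forall (r : int) (f : mor (shiftz T r M) M), ~ irreducible f)
  (F : endofunctor C) (HF : linear_functor F)
  (alpha : nat_trans (idF C) F)
  (Hsupp : forall X : C, in_support alpha X -> is_shift_of T M X)
  (Hnz : forall r : int, alpha (shiftz T r M) != 0)
  (Hind : forall r : int, indecomposable (F (shiftz T r M))) :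
  isomorphic (F M) (S M) /\
  (forall r : int, almost_vanishing T (alpha (shiftz T r M))) /\
  linckelmann_type T M alpha.
Proof.
have addC := tri_additive T.
have locM := indecomposable_local addC HKS HM.
(* All objects isomorphic to a shift are treated, as [linckelmann_type] requires; [Hnz] and [Hind]
   pass from the chosen representatives to [N] along the isomorphism [w]. *)
have main N : is_shift_of T M N ->
    isomorphic (F N) (S N) /\ almost_vanishing T (alpha N).
  move=> MN; have [r [w [w' [w'w ww']]]] := MN.
  apply: (@almost_vanishing_component _ _ T S F alpha N HKS HS).
  - exact: local_shift_of MN locM.
  - apply: (@local_isomorphic _ _ (F (shiftz T r M))).
      by apply: fmap_isomorphic; exists w', w.
    exact: indecomposable_local (Hind r).
  - apply: contra_neq (Hnz r) => alphaN0; have /= := naturality alpha w.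
    rewrite alphaN0 comp0r => alpha_w0.
    by rewrite -[alpha _]comp_idr -ww' comp_assoc alpha_w0 comp0l.
  move=> Y f locY irr; apply/eqP/negP => /negP nzY.
  have MY : is_shift_of T M Y.
    by apply: Hsupp; split=> //; apply: local_indecomposable.
  exact: no_irreducible_between_shifts Hirr _ _ f MY MN irr.
split; first by apply: (proj1 (main M _)); apply: (is_shift_of_shiftz T M 0).
split=> [r|]; first exact: (proj2 (main _ (is_shift_of_shiftz T M r))).
split=> // [V /main[]//|V indV nMV].
by apply/eqP/negP => /negP nzV; apply: nMV; apply: Hsupp.
Qed.
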